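(* Let $\mathcal{P}$ be a collection of probability distributions on $\mathcal{Z}^{n+1}$ and let $\mathcal{E}:\mathcal{Z}^{n+1}\to[0,\infty]$ be a fuzzy prediction set, with $\mathcal{E}^{z^n}(z):=\mathcal{E}(z^n,z)$. Let $\overline{C}_\alpha^{z^n}=\{z\in\mathcal{Z}:\mathcal{E}^{z^n}(z)<1/\alpha\}$ for $\alpha>0$. Then the collection of sublevel sets $(\overline{C}_\alpha^{Z^n})_{\alpha>0}$ satisfies $$\mathrm{E}_{\widetilde{\alpha}}^P\left[\frac{P\left(Z_{n+1}\notin\overline{C}_{\widetilde{\alpha}}^{Z^n}\mid\widetilde{\alpha}\right)}{\widetilde{\alpha}}\right]\le 1,\quad\text{for every }P\in\mathcal{P},$$ for every data-dependent significance level $\widetilde{\alpha}$, if and only if $\mathcal{E}^{Z^n}$ is valid for $\mathcal{P}$.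
   Context: $\mathcal{Z}$ is a measurable sample space and $Z^{n+1}=(Z^n,Z_{n+1})$ denotes a random element of $\mathcal{Z}^{n+1}$. A fuzzy prediction set for $Z_{n+1}$ is a measurable map $\mathcal{E}:\mathcal{Z}^{n+1}\to[0,\infty]$; it is valid for $\mathcal{P}$ if $\mathrm{E}^P[\mathcal{E}^{Z^n}(Z_{n+1})]\le 1$ for every $P\in\mathcal{P}$. A data-dependent significance level $\widetilde{\alpha}$ is a $(0,\infty)$-valued measurable function of the data $Z^{n+1}$ (it may depend on $Z_{n+1}$). $\mathrm{E}^P_{\widetilde\alpha}$ is the expectation over $\widetilde{\alpha}$ when $Z^{n+1}\sim P$. *)

(* Defs.v *)
From HB Require Import structures.
From mathcomp Require Import all_boot all_order all_algebra.
From mathcomp Require Import all_classical all_reals all_analysis.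
From mathcomp Require Import measurable_realfun.

Set Implicit Arguments.
Unset Strict Implicit.
Unset Printing Implicit Defensive.

Import Order.TTheory GRing.Theory Num.Theory.
Import numFieldNormedType.Exports.

Local Open Scope classical_set_scope.
Local Open Scope ring_scope.
Local Open Scope ereal_scope.

(* A point of Z^(n+1) is a tuple (z_1, ..., z_n, z_(n+1)), with the product
   sigma-algebra that the library puts on tuples. *)
Definition past (T : Type) (n : nat) (w : n.+1.-tuple T) : n.-tuple T :=
  [tuple tnth w (widen_ord (leqnSn n) i) | i < n].

Definition next (T : Type) (n : nat) (w : n.+1.-tuple T) : T :=
  tnth w ord_max.

Lemma rcons_past_next (T : Type) (n : nat) (w : n.+1.-tuple T) :
  [tuple of rcons (past w) (next w)] = w.
Proof.
apply: eq_from_tnth => i; rewrite (tnth_nth (next w)) /=.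
rewrite nth_rcons size_map size_enum_ord.
have [lt_in|le_ni] := ltnP i n.
  rewrite (nth_map (Ordinal lt_in)) ?size_enum_ord //.
  congr tnth; apply: val_inj => /=.
  by rewrite nth_enum_ord.
have ein : nat_of_ord i = n.
  by apply/eqP; rewrite eqn_leq le_ni -ltnS ltn_ord.
by rewrite ein eqxx /next; congr tnth; apply: val_inj.
Qed.

Section fuzzy_prediction_set.
Context (R : realType) (d : measure_display) (Z : measurableType d) (n : nat).

Definition is_fuzzy_prediction_set (E : n.+1.-tuple Z -> \bar R) : Prop :=
  measurable_fun [set: n.+1.-tuple Z] E /\ (forall w, 0 <= E w).

(* E^{z^n}(z) = E(z^n, z) *)
Definition fuzzy_set (E : n.+1.-tuple Z -> \bar R) (zn : n.-tuple Z) (z : Z) :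
    \bar R :=
  E [tuple of rcons zn z].

Definition valid (PP : set (probability (n.+1.-tuple Z) R))
    (E : n.+1.-tuple Z -> \bar R) : Prop :=
  forall P, PP P -> \int[P]_w fuzzy_set E (past w) (next w) <= 1.

Definition sublevel_set (E : n.+1.-tuple Z -> \bar R) (a : R)
    (zn : n.-tuple Z) : set Z :=
  [set z | fuzzy_set E zn z < (a^-1)%:E].

Definition noncoverage (E : n.+1.-tuple Z -> \bar R)
    (alpha : n.+1.-tuple Z -> R) : set (n.+1.-tuple Z) :=
  [set w | ~ sublevel_set E (alpha w) (past w) (next w)].

End fuzzy_prediction_set.

(* g is a version of x |-> P(A | X = x), i.e. g \o X is a version of the
   conditional probability of A given the sigma-algebra generated by X. Versions
   exist (cond_prob_exists) and are unique up to null sets of the law of X. *)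
Definition is_cond_prob (R : realType) (d d' : measure_display)
    (T : measurableType d) (T' : measurableType d') (P : probability T R)
    (X : {mfun T >-> T'}) (A : set T) (g : T' -> R) : Prop :=
  (distribution P X).-integrable [set: T'] (EFin \o g) /\
  (forall B : set T', measurable B ->
    \int[distribution P X]_(x in B) (g x)%:E = P (A `&` X @^-1` B)).

Section cond_prob_exists.
Context (R : realType) (d d' : measure_display) (T : measurableType d)
  (T' : measurableType d') (P : probability T R) (X : {mfun T >-> T'})
  (A : set T).

Let nu (B : set T') : \bar R := P (A `&` X @^-1` B).

Lemma cond_prob_exists : measurable A ->
  exists g : T' -> R, is_cond_prob P X A g.
Proof.
move=> mA.
have mX B : measurable B -> measurable (X @^-1` B).
  by move=> mB; rewrite -[X @^-1` B]setTI; exact: measurable_funP.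
have nu0 : nu set0 = 0 by rewrite /nu preimage_set0 setI0 measure0.
have nufin B : measurable B -> nu B \is a fin_num.
  by move=> mB; apply: fin_num_measure; apply: measurableI => //; exact: mX.
have nus : semi_sigma_additive nu.
  move=> F mF tF mUF; rewrite /nu preimage_bigcup setI_bigcupr.
  apply: measure_semi_sigma_additive.
  - by move=> i; apply: measurableI => //; exact: mX.
  - apply/trivIsetP => i j _ _ ij.
    move/trivIsetP : tF => /(_ i j I I ij) Fij.
    by rewrite setIACA setIid -preimage_setI Fij preimage_set0 setI0.
  - by rewrite -setI_bigcupr -preimage_bigcup; apply: measurableI => //; exact: mX.
pose NU : {charge set T' -> \bar R} :=
  HB.pack nu (isCharge.Build _ T' R nu nu0 nufin nus).
have dom : NU `<< distribution P X.
  apply/null_content_dominatesP => B mB PB0.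
  apply/eqP; rewrite eq_le measure_ge0 andbT -PB0.
  by apply: le_measure; rewrite ?inE; [apply: measurableI => //| |exact: subIsetr]; exact: mX.
exists (fine \o Radon_Nikodym NU (distribution P X)).
have fE : EFin \o (fine \o Radon_Nikodym NU (distribution P X))
    = Radon_Nikodym NU (distribution P X).
  by apply/funext => x /=; rewrite fineK// Radon_Nikodym_fin_num.
split; first by rewrite fE; exact: Radon_Nikodym_integrable.
move=> B mB; transitivity (NU B) => //.
rewrite (Radon_Nikodym_integral dom mB).
by apply: eq_integral => x _; rewrite -[RHS](congr1 (@^~ x) fE).
Qed.

End cond_prob_exists.

(* Main.v *)
From HB Require Import structures.
Require Import Defs.
From mathcomp Require Import all_boot all_order all_algebra.
From mathcomp Require Import all_classical all_reals all_analysis.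
From mathcomp Require Import measurable_realfun.
Import Order.TTheory GRing.Theory Num.Theory.
Import numFieldNormedType.Exports.
Import HBNNSimple.
Local Open Scope classical_set_scope.
Local Open Scope ring_scope.
Local Open Scope ereal_scope.

(** Conditioning on alpha turns the left-hand side into the P-expectation of
    [1{E >= 1/alpha} / alpha]. This random variable is at most [E], which gives
    validity => bound. Conversely, for a simple function [h] with [0 <= h <= E],
    taking [alpha = 1/h] where [h > 0] makes it at least [h], so [h] has
    expectation at most 1; the expectation of [E] is the supremum over such [h]. *)

(** Inversion is continuous on the open complement of 0, and any function is measurable on the
    singleton of 0. *)
Lemma measurable_invr (R : realType) :
  measurable_fun [set: R] (@GRing.inv R).
Proof.
rewrite -(setvU [set 0%R]); apply/measurable_funU => //.
  exact: measurableC.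
split; last exact: measurable_fun_set1.
apply: open_continuous_measurable_fun; first exact: closed_openC.
by move=> x; rewrite inE /= => /eqP x0; exact: inv_continuous.
Qed.

(** Having the same integrals over measurable sets, [f] and the Radon-Nikodym derivative of [nu]
    agree [mu]-almost everywhere, so the change of variables for the derivative passes to [f]. *)
Lemma integral_density (d : measure_display) (T : measurableType d)
    (R : realType) (nu : {measure set T -> \bar R})
    (mu : {sigma_finite_measure set T -> \bar R}) (f h : T -> \bar R) :
  mu.-integrable [set: T] f ->
  (forall B, measurable B -> \int[mu]_(x in B) f x = nu B) ->
  measurable_fun [set: T] h -> (forall x, 0 <= h x) ->
  \int[mu]_x (h x * f x) = \int[nu]_x h x.
Proof.
move=> fi fnu mh h0.
have nufin : fin_num_fun nu.
  move=> B mB; rewrite -fnu//; apply: integrable_fin_num => //.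
  exact: integrableS fi.
(* Restricting to the whole space leaves the values of [nu] unchanged; it only equips [nu] with the
   structure of a finite measure. *)
pose NU := mfrestr measurableT (fin_num_fun_lty nufin).
have NUE B : NU B = nu B by rewrite /NU /mfrestr /mrestr setIT.
have NUmu : NU `<< mu.
  apply/null_content_dominatesP => B mB muB0.
  rewrite NUE -fnu//; apply: null_set_integral => //.
  exact/measurable_funTS/measurable_int/fi.
pose f' := Radon_Nikodym_SigmaFinite.f NU mu.
have f'i : mu.-integrable [set: T] f'.
  exact: Radon_Nikodym_SigmaFinite.f_integrable.
transitivity (\int[mu]_x (h x * f' x)); last first.
  rewrite Radon_Nikodym_SigmaFinite.change_of_variables//.
  by apply: eq_measure_integral => B mB _; exact: NUE.
have ff' : ae_eq mu [set: T] f f'.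
  apply: integral_ae_eq => //; first exact: measurable_int f'i.
  move=> B _ mB; rewrite fnu// -NUE.
  exact: (Radon_Nikodym_SigmaFinite.f_integral NUmu mB).
apply: ae_eq_integral => //.
- by apply: emeasurable_funM => //; exact: measurable_int fi.
- by apply: emeasurable_funM => //; exact: measurable_int f'i.
- exact: ae_eqe_mul2l.
Qed.

(** Two densities are at work: [g] is that of the image under [X] of [P] restricted to [A], relative
    to the law of [X], and the indicator of [A] is that of the restricted measure, relative to
    [P]. *)
Lemma integral_cond_prob (R : realType) (d d' : measure_display)
    (T : measurableType d) (T' : measurableType d') (P : probability T R)
    (X : {mfun T >-> T'}) (A : set T) (g : T' -> R) (h : T' -> \bar R) :
  measurable A -> is_cond_prob P X A g ->
  measurable_fun [set: T'] h -> (forall x, 0 <= h x) ->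
  \int[distribution P X]_x (h x * (g x)%:E) =
  \int[P]_w (h (X w) * (\1_A w)%:E).
Proof.
move=> mA [gi gA] mh h0.
have mX : measurable_fun [set: T] X by exact: measurable_funP.
pose PA := mrestr P mA.
rewrite (@integral_density _ _ _ (pushforward PA X))//; last first.
  by move=> B mB; rewrite gA// setIC.
rewrite ge0_integral_pushforward// preimage_setT.
rewrite (@integral_density _ _ _ PA)//.
- exact: integrable_indic.
- by move=> B mB; rewrite integral_indic// setIC.
- exact: measurableT_comp.
Qed.

Arguments integral_cond_prob {R d d' T T' P X A g h}.

Lemma integral_cond_prob_div (R : realType) (d : measure_display)
    (T : measurableType d) (P : probability T R) (alpha : {mfun T >-> R})
    (A : set T) (g : R -> R) :
  (forall w, (0 < alpha w)%R) -> measurable A -> is_cond_prob P alpha A g ->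
  \int[distribution P alpha]_a (g a / a)%:E =
  \int[P]_w (\1_A w / alpha w)%:E.
Proof.
move=> alpha0 mA gA.
have minv := measurable_invr R.
have [/measurable_int/measurable_EFinP mg _] := gA.
have mn : measurable_fun [set: R] (fun a : R => `|a^-1|%:E).
  by apply/measurable_EFinP; exact: measurableT_comp.
(* The weight must be nonnegative on all of [R], whereas the inverse of [a] is negative for [a < 0].
   The absolute value repairs this, and changes the integrand only on the nonpositive reals, which
   are null for the law of [alpha]. *)
transitivity (\int[distribution P alpha]_a (`|a^-1|%:E * (g a)%:E)).
  apply: ae_eq_integral => //.
  - by apply/measurable_EFinP; exact: measurable_funM.
  - by apply: emeasurable_funM => //; exact/measurable_EFinP.
  exists [set a | (a <= 0)%R]; split.
  - rewrite -set_itvNyc; exact: measurable_itv.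
  - transitivity (P set0); last exact: measure0.
    by congr (P _); rewrite -subset0 => w /=; rewrite leNgt alpha0.
  - move=> a /=; apply: contra_notP => /negP; rewrite -ltNge => a0 _.
    by rewrite -EFinM ger0_norm ?invr_ge0 ?ltW// mulrC.
rewrite (integral_cond_prob mA gA)//.
apply: eq_integral => w _.
by rewrite -EFinM ger0_norm ?invr_ge0 ?ltW// mulrC.
Qed.

Arguments integral_cond_prob_div {R d T P alpha A g}.

Lemma fuzzy_set_past_next (R : realType) (d : measure_display)
    (Z : measurableType d) (n : nat) (E : n.+1.-tuple Z -> \bar R) w :
  fuzzy_set E (past w) (Defs.next w) = E w.
Proof. by rewrite /fuzzy_set rcons_past_next. Qed.

Lemma noncoverageE (R : realType) (d : measure_display)
    (Z : measurableType d) (n : nat) (E : n.+1.-tuple Z -> \bar R)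
    (alpha : n.+1.-tuple Z -> R) :
  noncoverage E alpha = [set w | ((alpha w)^-1)%:E <= E w].
Proof.
apply/seteqP; split=> w;
  by rewrite /noncoverage /sublevel_set /= fuzzy_set_past_next leNgt => /negP.
Qed.

Lemma measurable_noncoverage (R : realType) (d : measure_display)
    (Z : measurableType d) (n : nat) (E : n.+1.-tuple Z -> \bar R)
    (alpha : {mfun n.+1.-tuple Z >-> R}) :
  measurable_fun [set: n.+1.-tuple Z] E -> measurable (noncoverage E alpha).
Proof.
move=> mE; rewrite noncoverageE -[X in measurable X]setTI.
apply: measurable_lee => //; apply/measurable_EFinP.
by apply: (measurableT_comp (measurable_invr R)); exact: measurable_funP.
Qed.

Arguments measurable_noncoverage {R d Z n E alpha}.

Theorem theorem3 (R : realType) (d : measure_display) (Z : measurableType d)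
    (n : nat) (PP : set (probability (n.+1.-tuple Z) R))
    (E : n.+1.-tuple Z -> \bar R) (hE : is_fuzzy_prediction_set E) :
  (forall alpha : {mfun n.+1.-tuple Z >-> R},
    (forall w, (0 < alpha w)%R) ->
    forall P : probability (n.+1.-tuple Z) R, PP P ->
    forall g : R -> R, is_cond_prob P alpha (noncoverage E alpha) g ->
      \int[distribution P alpha]_a (g a / a)%:E <= 1)
  <-> valid PP E.
Proof.
case: hE => mE E0; split=> [bound|vE].
- move=> P PPP; under eq_integral do rewrite fuzzy_set_past_next.
  rewrite ge0_integralTE//; apply: ge_ereal_sup => _ [h hE <-].
  (* The value 1 where [h] vanishes only keeps the level positive; any positive constant would
     do. *)
  pose a w : R := if (0 < h w)%R then (h w)^-1%R else 1%R.
  have mh : measurable_fun [set: n.+1.-tuple Z] h by exact: measurable_funP.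
  have ma : measurable_fun [set: n.+1.-tuple Z] a.
    apply: measurable_fun_ifT => //; first exact: measurable_fun_ltr.
    exact: (measurableT_comp (measurable_invr R)).
  pose alpha : {mfun n.+1.-tuple Z >-> R} :=
    HB.pack a (isMeasurableFun.Build _ _ _ _ a ma).
  have alpha0 w : (0 < alpha w)%R.
    by rewrite /alpha /= /a; case: ifPn => //; rewrite invr_gt0.
  have mA := measurable_noncoverage (alpha := alpha) mE.
  (* [bound] speaks of versions of the conditional probability, so one must exist before it yields
     anything. *)
  have [g gA] := cond_prob_exists P alpha mA.
  apply: le_trans (bound alpha alpha0 P PPP g gA).
  rewrite (integral_cond_prob_div alpha0 mA gA) -integralT_nnsfun.
  apply: ge0_le_integral => //.
  + by move=> w _; rewrite lee_fin.
  + exact/measurable_EFinP.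
  + apply/measurable_EFinP; apply: measurable_funM => //.
    exact: (measurableT_comp (measurable_invr R)).
  (* Where [h] vanishes, the right-hand side is nonnegative. Where [h w > 0], the inverse of
     [alpha w] is [h w], which is at most [E w]: hence [w] is not covered and the two sides are
     equal. *)
  + move=> w _; rewrite lee_fin.
    have [hw0|] := ltP 0%R (h w); last first.
      by move/le_trans; apply; rewrite divr_ge0// ltW.
    rewrite indicE mem_set; last first.
      by rewrite noncoverageE /= /a hw0 invrK; exact: hE.
    by rewrite mul1r /alpha /= /a hw0 invrK.
- move=> alpha alpha0 P PPP g gA.
  have mA := measurable_noncoverage (alpha := alpha) mE.
  rewrite (integral_cond_prob_div alpha0 mA gA).
  apply: le_trans (vE P PPP).
  under [leRHS]eq_integral do rewrite fuzzy_set_past_next.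
  apply: ge0_le_integral => //.
  + by move=> w _; rewrite lee_fin divr_ge0// ltW.
  + apply/measurable_EFinP; apply: measurable_funM => //.
    by apply: (measurableT_comp (measurable_invr R)); exact: measurable_funP.
  (* On the noncoverage event the inverse of [alpha w] is at most [E w] by definition; off it the
     left-hand side is 0. *)
  + move=> w _; rewrite indicE; case: (boolP (w \in _)) => [|_].
      by rewrite inE noncoverageE /= mul1r.
    by rewrite mul0r.
Qed.
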